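(* Let $\Gamma$ be an infinite countable group and let $p,q\in[1,\infty)$. Let $B_1^{\ell^p}$ and $B_1^{\ell^q}$ be the unit balls of $\ell^p(\Gamma;\mathbb{R})$ and $\ell^q(\Gamma;\mathbb{R})$ respectively, both endowed with the natural action of $\Gamma$ and each endowed with a metric of the form $d^{\{F_i\},\{a_i\},r}$ (as defined in the context). When $q>p$, there is no $\Gamma$-equivariant Lipschitz homeomorphism $f:B_1^{\ell^p}\to B_1^{\ell^q}$. Moreover, for $\alpha\in(0,1]$, if $\alpha q>p$, there is no $\Gamma$-equivariant map $f:B_1^{\ell^p}\to B_1^{\ell^q}$ which is H\''older continuous of exponent $\alpha$.
   Context: For $1\le p<\infty$, $\ell^p(\Gamma;\mathbb{R})$ is the set of functions $x:\Gamma\to\mathbb{R}$ with $\sum_{\gamma\in\Gamma}|x(\gamma)|^p<\infty$, with norm $\|x\|_{\ell^p}=(\sum_{\gamma\in\Gamma}|x(\gamma)|^p)^{1/p}$, and $B_1^{\ell^p}=\{x\in\ell^p(\Gamma;\mathbb{R}) : \|x\|_{\ell^p}\le 1\}$. The natural action of $\Gamma$ is $(\gamma x)(\cdot)=x(\gamma^{-1}\,\cdot)$. Metrics: let $\{F_i\}_{i\ge1}$ be a sequence of finite (nonempty) subsets of $\Gamma$ with $\bigcup_i F_i=\Gamma$, let $\{a_i\}_{i\ge1}$ be a summable sequence of positive real numbers normalized by $\sum_{i\ge1}a_i=1$, and let $r\in[1,\infty]$. For $r<\infty$ set $$d^{\{F_i\},\{a_i\},r}(x_1,x_2)=\Big(\sum_{i\ge1}a_i\frac{1}{|F_i|}\|x_1-x_2\|_{\ell^r(F_i)}^r\Big)^{1/r},\qquad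 \|x_1-x_2\|_{\ell^r(F_i)}^r=\sum_{\gamma\in F_i}|x_1(\gamma)-x_2(\gamma)|^r,$$ and for $r=\infty$ set $d^{\{F_i\},\{a_i\},\infty}(x_1,x_2)=\sum_{i\ge1}a_i\|x_1-x_2\|_{\ell^\infty(F_i)}$, where $\|x\|_{\ell^\infty(F_i)}=\max_{\gamma\in F_i}|x(\gamma)|$. The topology on the unit balls is the one induced by these metrics (it is the product topology). The parameters $\{F_i\},\{a_i\},r$ may be different for the two balls. A Lipschitz homeomorphism is a homeomorphism $f$ that is a Lipschitz map (no Lipschitz condition on $f^{-1}$ is required). A map $f:(X,d)\to(X',d')$ is H\''older continuous of exponent $\alpha$ if there is $c'>0$ with $d'(f(x),f(y))\le c'\,d(x,y)^\alpha$ for all $x,y\in X$. A map $f$ is $\Gamma$-equivariant if $f(\gamma x)=\gamma f(x)$ for all $\gamma\in\Gamma$ and all $x$.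
   Formalization: In the second claim, ''map'' is read as ''homeomorphism'', as in the first claim: taken literally it is false, since the constant map 0 is equivariant and Hölder continuous of every exponent. *)

(* Defs.v *)
From HB Require Import structures.
From mathcomp Require Import all_boot all_order all_algebra finmap.
From mathcomp Require Import all_classical all_reals all_analysis.
Set Implicit Arguments.
Unset Strict Implicit.
Unset Printing Implicit Defensive.
Import Order.TTheory GRing.Theory Num.Theory.
Import numFieldNormedType.Exports.
Local Open Scope classical_set_scope.
Local Open Scope ring_scope.

Section unit_ball.
Context {R : realType} {G : groupType}.
Implicit Types (p : R) (x : G -> R) (g : G).

Definition lp_sum p x : \bar R := \esum_(g in [set: G]) (`|x g| `^ p)%:E.

Definition lp_space p : set (G -> R) := [set x | (lp_sum p x < +oo)%E].

Definition lp_norm p x : R := fine (lp_sum p x) `^ p^-1.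

Definition lp_ball p : set (G -> R) :=
  [set x | lp_space p x /\ lp_norm p x <= 1].

Definition translate g x : G -> R := fun h => x (g^-1 * h)%g.

Lemma lp_sum_translate p g x : lp_sum p (translate g x) = lp_sum p x.
Proof.
rewrite /lp_sum /translate.
rewrite [RHS](reindex_esum [set: G] [set: G] (fun h => (g^-1 * h)%g))//.
split=> [//|h1 h2 _ _ /mulgI//|h _].
by exists (g * h)%g => //; rewrite mulKg.
Qed.

Lemma lp_ball_translate p g (x : lp_ball p) : lp_ball p (translate g (val x)).
Proof.
have := set_valP x.
by rewrite /lp_ball /lp_space /lp_norm /= lp_sum_translate.
Qed.

Definition ball_act p g (x : lp_ball p) : lp_ball p :=
  SigSub (mem_set (lp_ball_translate g x)).

Definition equivariant p q (f : lp_ball p -> lp_ball q) : Prop :=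
  forall g (x : lp_ball p), f (ball_act g x) = ball_act g (f x).

End unit_ball.

Section ball_metric.
Context {R : realType} {G : groupType}.

(* The sequences {F_i} and {a_i}, i >= 1, are indexed from 0. *)
Definition metric_data (F : nat -> {fset G}) (a : nat -> R) (r : \bar R) :
    Prop :=
  [/\ (forall i, F i != fset0),
      (forall g, exists i, g \in F i),
      (forall i, 0 < a i),
      series a @ \oo --> (1 : R) &
      (1%:E <= r)%E].

(* The default value 0 of the maximum is harmless: F i is nonempty and the
   entries are nonnegative.  On differences of elements of unit balls the
   terms of both series are bounded by a constant multiple of a i, so the
   limits below exist. *)
Definition ball_dist (F : nat -> {fset G}) (a : nat -> R) (r : \bar R)
    (x y : G -> R) : R :=
  match r with
  | s%:E => limn (series (fun i =>
      a i * (#|` F i|%:R^-1 * \sum_(g <- F i) `|x g - y g| `^ s))) `^ s^-1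
  | +oo%E => limn (series (fun i =>
      a i * \big[Num.max/0]_(g <- F i) `|x g - y g|))
  | -oo%E => 0
  end.

Definition lp_ball_dist p (F : nat -> {fset G}) (a : nat -> R) (r : \bar R)
    (x y : lp_ball p) : R :=
  ball_dist F a r (val x) (val y).

End ball_metric.

Section metric_maps.
Context {R : realType} {X Y : Type}.
Implicit Types (dX : X -> X -> R) (dY : Y -> Y -> R) (f : X -> Y).

Definition lipschitz_map dX dY f : Prop :=
  exists2 c : R, 0 < c & forall x y, dY (f x) (f y) <= c * dX x y.

Definition hoelder_map (alpha : R) dX dY f : Prop :=
  exists2 c : R, 0 < c & forall x y, dY (f x) (f y) <= c * (dX x y `^ alpha).

End metric_maps.

Definition metric_continuous {R : realType} {X Y : Type}
    (dX : X -> X -> R) (dY : Y -> Y -> R) (f : X -> Y) : Prop :=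
  forall x (e : R), 0 < e ->
    exists2 d : R, 0 < d & forall y, dX x y < d -> dY (f x) (f y) < e.

Definition homeomorphism {R : realType} {X Y : Type}
    (dX : X -> X -> R) (dY : Y -> Y -> R) (f : X -> Y) : Prop :=
  exists g : Y -> X,
    [/\ cancel f g, cancel g f, metric_continuous dX dY f
      & metric_continuous dY dX g].

(* Main.v *)
Require Import Defs.
From HB Require Import structures.
From mathcomp Require Import all_boot all_order all_algebra finmap.
From mathcomp Require Import all_classical all_reals all_analysis.
Import Order.TTheory GRing.Theory Num.Theory.
Import numFieldNormedType.Exports.
Local Open Scope classical_set_scope.
Local Open Scope ring_scope.

(** The obstruction is a count of separated points that grows with the window
    in which they are observed.  Fix a resolution [t].  On a finite window
    [E] of [G], a point of the unit ball of l^p is known up to [2 t] once one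
    knows its values at the coordinates where it exceeds [t] in absolute value.
    There are at most [t^-p] such coordinates, so the ball contains at most
    [(constant * |E|) ^ n] points that are separated by [2 t] on [E], where [n]
    is the integral part of [t^-p] ([lp_ball_separated_card]).  Conversely the
    unit ball of l^q contains the vectors with [m] coordinates equal to [eps],
    as long as [m eps^q <= 1]; with one such coordinate in each of [m] blocks
    of [k] points there are [k ^ m] of them, and any two differ by [eps] at
    some point.

    Let [f] be equivariant and Hoelder of exponent [alpha].  Evaluation at the
    identity is Lipschitz for the target metric, hence by equivariance
    [f x g] is a Hoelder function of the translate of [x] by [g^-1]
    ([equivariant_hoelder_coord]).  Up to [t], the source metric sees only a
    finite set [K] of coordinates ([ball_dist_lt_of_finite]).  So if [f] is
    onto, preimages of vectors that differ by [eps ~ t^alpha] at a point [g]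
    differ by [2 t] somewhere on [g K].  Counting gives
    [k ^ m <= (D k) ^ n] with [D] independent of [k], which fails for large [k]
    as soon as [n < m].  Such an [m] with [m eps^q <= 1] exists for small [t]
    exactly because [t^-p] is eventually much smaller than
    [eps^-q ~ t^-(alpha q)] when [p < alpha q]
    ([exists_scale_fewer_large_coords]).

    The set [K] depends on [t], on the exponent of the metric and on the
    weights, possibly in a wild way; it enters only through the constant [D].
    This is why all metrics of the family can be treated at once.  A Lipschitz
    map is the case [alpha = 1]. *)

(** * Series with weights of total mass one *)

Section weighted_series.
Context {R : realType} (a : nat -> R).
Hypothesis a_gt0 : forall i, 0 < a i.
Hypothesis a_sum1 : series a @ \oo --> (1 : R).

Lemma nondecreasing_weighted (b : nat -> R) : (forall i, 0 <= b i) ->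
  nondecreasing_seq (series (fun i => a i * b i)).
Proof.
move=> b0; apply: nondecreasing_series => n _ _.
by rewrite mulr_ge0// ltW.
Qed.

Lemma series_weight_le1 n : series a n <= 1.
Proof.
rewrite -(cvg_lim (@Rhausdorff R) a_sum1).
apply: nondecreasing_cvgn_le; last by apply/cvg_ex; exists 1.
by apply: nondecreasing_series => i _ _; exact: ltW.
Qed.

Lemma is_cvg_weighted (b : nat -> R) B : (forall i, 0 <= b i <= B) ->
  cvgn (series (fun i => a i * b i)).
Proof.
move=> bB; apply: nondecreasing_is_cvgn.
  by apply: nondecreasing_weighted => i; case/andP: (bB i).
exists B => _ [n _ <-].
have B0 : 0 <= B by case/andP: (bB 0%N) => /le_trans; apply.
rewrite -[leRHS]mul1r (le_trans _ (ler_wpM2r B0 (series_weight_le1 n)))//.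
rewrite /series/= mulr_suml ler_sum// => i _.
by rewrite ler_wpM2l ?(ltW (a_gt0 _))//; case/andP: (bB i).
Qed.

Lemma weighted_term_le_lim (b : nat -> R) B i : (forall i, 0 <= b i <= B) ->
  a i * b i <= limn (series (fun i => a i * b i)).
Proof.
move=> bB; have b0 j : 0 <= b j by case/andP: (bB j).
have := nondecreasing_cvgn_le _ (is_cvg_weighted _ _ bB) i.+1.
move=> /(_ (nondecreasing_weighted _ b0)); apply: le_trans.
rewrite seriesSr lerDr /series/= sumr_ge0// => j _.
by rewrite mulr_ge0// ltW.
Qed.

Lemma weighted_lim_ge0 (b : nat -> R) B : (forall i, 0 <= b i <= B) ->
  0 <= limn (series (fun i => a i * b i)).
Proof.
move=> bB; apply: le_trans (weighted_term_le_lim _ _ 0%N bB).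
by rewrite mulr_ge0 ?(ltW (a_gt0 _))//; case/andP: (bB 0%N).
Qed.

(** The index [I] must not depend on [b]: this uniformity lets one finite set
    of coordinates control the distance of all pairs of points.  Beyond [I] the
    weights have total mass at most [e / (`|B| + 1)]. *)
Lemma weighted_lim_le (B e : R) : 0 < e -> exists I : nat,
  forall (b : nat -> R) (c : R), 0 <= c -> (forall i, 0 <= b i <= B) ->
    (forall i, (i < I)%N -> b i <= c) ->
    limn (series (fun i => a i * b i)) <= c + e.
Proof.
move=> e0; have B10 : 0 < `|B| + 1 by rewrite ltr_wpDl.
have [I HI] : exists I, 1 - series a I < e / (`|B| + 1).
  move/cvgrPdist_lt: (a_sum1) => /(_ _ (divr_gt0 e0 B10)).
  move=> [I _ /(_ I (leqnn I))/= HI].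
  by exists I; exact: le_lt_trans (ler_norm _) HI.
exists I => b c c0 bB bc; apply: limr_le; first exact: is_cvg_weighted bB.
near=> n.
have In : (I <= n)%N by near: n; exists I.
have B0 : 0 <= B by case/andP: (bB 0%N) => /le_trans; apply.
rewrite /series/= (big_cat_nat (n := I))//= lerD//.
  apply: (@le_trans _ _ (series a I * c)); last first.
    by rewrite ler_piMl// series_weight_le1.
  rewrite /series/= mulr_suml big_nat [leRHS]big_nat ler_sum// => i /andP[_ iI].
  by rewrite ler_wpM2l ?(ltW (a_gt0 _)) ?bc.
apply: (@le_trans _ _ ((1 - series a I) * B)).
  apply: (@le_trans _ _ ((series a n - series a I) * B)); last first.
    by rewrite ler_wpM2r// lerB// series_weight_le1.
  rewrite sub_series_geq// mulr_suml ler_sum// => i _.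
  by rewrite ler_wpM2l ?(ltW (a_gt0 _))//; case/andP: (bB i).
apply: (@le_trans _ _ (e / (`|B| + 1) * B)).
  by rewrite ler_wpM2r// ltW.
rewrite mulrAC -mulrA ler_piMr ?(ltW e0)// ler_pdivrMr// mul1r.
by rewrite (le_trans (ler_norm _))// lerDl.
Unshelve. all: by end_near. Qed.

End weighted_series.

(** * Averages and maxima over a finite set *)

Section local_quantities.
Context {R : realType} {G : groupType}.
Implicit Types (F : {fset G}) (u : G -> R).

Lemma fset_size_gt0 F : F != fset0 -> 0 < #|` F|%:R :> R.
Proof. by rewrite ltr0n cardfs_gt0. Qed.

Lemma mean_ge0 F u : (forall g, 0 <= u g) ->
  0 <= #|` F|%:R^-1 * \sum_(g <- F) u g.
Proof. by move=> u0; rewrite mulr_ge0 ?invr_ge0// sumr_ge0. Qed.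

Lemma mean_le F u B : F != fset0 -> (forall g, g \in F -> u g <= B) ->
  #|` F|%:R^-1 * \sum_(g <- F) u g <= B.
Proof.
move=> F0 uB; rewrite mulrC ler_pdivrMr ?fset_size_gt0// mulr_natr.
apply: (@le_trans _ _ (\sum_(g <- F) B)); last first.
  by rewrite big_const_seq count_predT iter_addr addr0.
by rewrite big_seq [leRHS]big_seq ler_sum.
Qed.

Lemma bigmax_fset_ge0 F u : 0 <= \big[Num.max/0]_(g <- F) u g.
Proof. by elim/big_rec: _ => // g x _ x0; rewrite le_max x0 orbT. Qed.

Lemma bigmax_fset_le F u B : 0 <= B -> (forall g, g \in F -> u g <= B) ->
  \big[Num.max/0]_(g <- F) u g <= B.
Proof.
move=> B0 uB; rewrite big_seq; elim/big_rec: _ => // g x gF xB.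
by rewrite ge_max uB.
Qed.

Lemma bigmax_fset_ge F u g : g \in F -> u g <= \big[Num.max/0]_(h <- F) u h.
Proof. by move=> gF; exact: le_bigmax_seq. Qed.

Lemma sum_fset_ge F u g : (forall h, 0 <= u h) -> g \in F ->
  u g <= \sum_(h <- F) u h.
Proof.
move=> u0 gF; rewrite (big_rem g)//= lerDl.
by elim/big_rec: _ => // h v _ v0; rewrite addr_ge0.
Qed.

End local_quantities.

(** * Comparison of the metrics with coordinates *)

Section metric_estimates.
Context {R : realType} {G : groupType}.
Variables (F : nat -> {fset G}) (a : nat -> R) (r : \bar R).
Hypothesis data : metric_data F a r.
Let unit_box : set (G -> R) := [set x | forall g, `|x g| <= 1].

Let diff_le2 x y g : unit_box x -> unit_box y -> `|x g - y g| <= 2.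
Proof. by move=> x1 y1; rewrite (le_trans (ler_normB _ _))// lerD. Qed.

Let mean_bounded s x y : 0 <= s -> unit_box x -> unit_box y -> forall i,
  0 <= #|` F i|%:R^-1 * \sum_(g <- F i) `|x g - y g| `^ s <= 2 `^ s.
Proof.
case: data => F0 _ _ _ _ s0 x1 y1 i.
apply/andP; split; first by apply: mean_ge0 => g; exact: powR_ge0.
by apply: mean_le => // g _; rewrite ge0_ler_powR ?nnegrE ?diff_le2.
Qed.

Let max_bounded x y : unit_box x -> unit_box y -> forall i,
  0 <= \big[Num.max/0]_(g <- F i) `|x g - y g| <= 2.
Proof.
move=> x1 y1 i; apply/andP; split; first exact: bigmax_fset_ge0.
by apply: bigmax_fset_le => // g _; exact: diff_le2.
Qed.

Lemma ball_dist_ge0 x y : unit_box x -> unit_box y -> 0 <= ball_dist F a r x y.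
Proof.
case: data => _ _ a0 a1 _ x1 y1; case: r => [s| |]//=; first exact: powR_ge0.
by apply: weighted_lim_ge0 a0 a1 _ _ (max_bounded _ _ x1 y1).
Qed.

(** Some [F i] contains [g], and the [i]-th term of the series alone already
    controls the coordinate [g]. *)
Lemma coordinate_le_ball_dist (g : G) : exists2 C : R, 0 < C &
  forall x y, unit_box x -> unit_box y ->
    `|x g - y g| <= C * ball_dist F a r x y.
Proof.
case: data => F0 /(_ g)[i gi] a0 a1.
move: mean_bounded max_bounded; case: r => [s| |]//= mb Mb.
- rewrite lee_fin => s1; have s0 : 0 < s by exact: lt_le_trans s1.
  have sn0 : s != 0 by rewrite gt_eqF.
  have D0 : 0 < a i * #|` F i|%:R^-1.
    by rewrite mulr_gt0// invr_gt0 fset_size_gt0.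
  exists ((a i * #|` F i|%:R^-1)^-1 `^ s^-1).
    by rewrite powR_gt0// invr_gt0.
  move=> x y x1 y1.
  rewrite -powRM ?invr_ge0 ?(ltW D0)//; last first.
    by apply: weighted_lim_ge0 a0 a1 _ _ (mb s _ _ (ltW s0) x1 y1).
  rewrite -[leLHS]powRr1// -[X in _ `^ X](mulfV sn0) powRrM.
  rewrite ge0_ler_powR ?invr_ge0 ?(ltW s0) ?nnegrE ?powR_ge0//.
    rewrite mulr_ge0 ?invr_ge0 ?(ltW D0)//.
    by apply: weighted_lim_ge0 a0 a1 _ _ (mb s _ _ (ltW s0) x1 y1).
  rewrite ler_pdivlMl//.
  have := weighted_term_le_lim _ a0 a1 _ _ i (mb s _ _ (ltW s0) x1 y1).
  apply: le_trans.
  rewrite -mulrA ler_wpM2l ?(ltW (a0 _))// ler_wpM2l ?invr_ge0//.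
  by apply: (sum_fset_ge _ (fun h => `|x h - y h| `^ s)).
- move=> _; exists (a i)^-1; first by rewrite invr_gt0.
  move=> x y x1 y1; rewrite ler_pdivlMl//.
  apply: le_trans (weighted_term_le_lim _ a0 a1 _ _ i (Mb _ _ x1 y1)).
  rewrite ler_wpM2l ?(ltW (a0 _))//.
  exact: (bigmax_fset_ge _ (fun h => `|x h - y h|)).
Qed.

(** The coordinates outside of the first few [F i] carry little weight, and
    they are bounded, so they cannot bring the distance from [c] up to [d]. *)
Lemma ball_dist_lt_of_finite (d c : R) : 0 <= c -> c < d -> exists K : seq G,
  forall x y, unit_box x -> unit_box y ->
    (forall g, g \in K -> `|x g - y g| <= c) -> ball_dist F a r x y < d.
Proof.
move=> c0 cd; have d0 : 0 < d by exact: le_lt_trans cd.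
have FK I i g : (i < I)%N -> g \in F i ->
    g \in flatten [seq enum_fset (F j) | j <- iota 0 I].
  move=> iI gi; apply/flattenP; exists (enum_fset (F i)) => //.
  by apply: map_f; rewrite mem_iota.
case: data => F0 _ a0 a1.
move: mean_bounded max_bounded; case: r => [s| |]//= mb Mb.
- rewrite lee_fin => s1; have s0 : 0 < s by exact: lt_le_trans s1.
  have sn0 : s != 0 by rewrite gt_eqF.
  have cds : c `^ s < d `^ s by rewrite gt0_ltr_powR ?nnegrE// ltW.
  have e0 : 0 < (d `^ s - c `^ s) / 2 by rewrite divr_gt0// subr_gt0.
  have [I HI] := weighted_lim_le _ a0 a1 (2 `^ s) _ e0.
  exists (flatten [seq enum_fset (F j) | j <- iota 0 I]) => x y x1 y1 xy.
  rewrite -[ltRHS]powRr1 ?(ltW d0)// -[X in _ < _ `^ X](mulfV sn0) powRrM.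
  rewrite gt0_ltr_powR ?invr_gt0// ?nnegrE ?powR_ge0//.
    by apply: weighted_lim_ge0 a0 a1 _ _ (mb s _ _ (ltW s0) x1 y1).
  apply: le_lt_trans (HI _ (c `^ s) _ (mb s _ _ (ltW s0) x1 y1) _) _.
  + exact: powR_ge0.
  + move=> i iI; apply: mean_le => // g gi.
    by rewrite ge0_ler_powR ?nnegrE ?(ltW s0)// xy// (FK _ _ _ iI).
  + by rewrite -ltrBrDl ltr_pdivrMr// ltr_pMr ?subr_gt0// ltr1n.
- move=> _; have e0 : 0 < (d - c) / 2 by rewrite divr_gt0// subr_gt0.
  have [I HI] := weighted_lim_le _ a0 a1 2 _ e0.
  exists (flatten [seq enum_fset (F j) | j <- iota 0 I]) => x y x1 y1 xy.
  apply: le_lt_trans (HI _ c c0 (Mb _ _ x1 y1) _) _.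
  + move=> i iI; apply: bigmax_fset_le => // g gi.
    by rewrite xy// (FK _ _ _ iI).
  + by rewrite -ltrBrDl ltr_pdivrMr// ltr_pMr ?subr_gt0// ltr1n.
Qed.

End metric_estimates.

(** * Unit balls of l^p *)

Section lp_balls.
Context {R : realType} {G : groupType}.
Implicit Types (p t : R) (x : G -> R) (s : seq G).

Lemma powR_le1 p t : 0 < p -> 0 <= t -> (t `^ p <= 1) = (t <= 1).
Proof.
move=> p0 t0; have E1 : 1 `^ p = 1 :> R by rewrite powR1.
have [t1|t1] := leP t 1.
  by rewrite -E1 ge0_ler_powR ?nnegrE ?(ltW p0) ?ler01.
by apply/negbTE; rewrite -ltNge -E1 gt0_ltr_powR ?nnegrE ?ler01.
Qed.

Lemma lp_ball_sum_le1 p x s : 0 < p -> lp_ball p x -> uniq s ->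
  \sum_(g <- s) `|x g| `^ p <= 1.
Proof.
move=> p0 [xoo x1] us.
have S0 : (0 <= lp_sum p x)%E.
  by apply: esum_ge0 => g _; rewrite lee_fin powR_ge0.
have Sfin : lp_sum p x \is a fin_num by rewrite ge0_fin_numE.
have S1 : fine (lp_sum p x) <= 1.
  by move: x1; rewrite /lp_norm powR_le1 ?invr_gt0// fine_ge0.
apply: le_trans S1; rewrite -lee_fin fineK// -sumEFin.
apply: esum_ge; exists [set` s]; first by split => //; exact: finite_seq.
by rewrite fsbig_seq.
Qed.

Lemma lp_ball_coord_le1 p x g : 0 < p -> lp_ball p x -> `|x g| <= 1.
Proof.
move=> p0 xp; have /(_ isT) := @lp_ball_sum_le1 _ _ [:: g] p0 xp.
by rewrite big_seq1 powR_le1.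
Qed.

Lemma lp_ball_count_large p x t s : 0 < p -> 0 <= t -> lp_ball p x -> uniq s ->
  (count (fun g => t <= `|x g|) s)%:R * t `^ p <= 1.
Proof.
move=> p0 t0 xp us; apply: le_trans (lp_ball_sum_le1 _ _ _ p0 xp us).
rewrite mulr_natl -size_filter.
rewrite (bigID (fun g => t <= `|x g|))/= ler_wpDr//.
  by rewrite sumr_ge0// => g _; exact: powR_ge0.
rewrite -big_filter.
apply: (@le_trans _ _ (\sum_(g <- [seq g <- s | t <= `|x g|]) t `^ p)).
  by rewrite big_const_seq count_predT iter_addr addr0.
rewrite big_seq [leRHS]big_seq ler_sum// => g.
rewrite mem_filter => /andP[tg _].
by rewrite ge0_ler_powR ?nnegrE ?(ltW p0).
Qed.

Lemma lp_ball_indicator p t s : 0 < p -> 0 <= t -> uniq s ->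
  (size s)%:R * t `^ p <= 1 -> lp_ball p (fun g => if g \in s then t else 0).
Proof.
move=> p0 t0 us st.
have SE : lp_sum p (fun g => if g \in s then t else 0) =
    ((size s)%:R * t `^ p)%:E.
  transitivity (\esum_(g in [set` s]) (t `^ p)%:E).
    rewrite esum_mkcond; apply: eq_esum => g _.
    rewrite mem_setE; case: ifP => _; first by rewrite ger0_norm.
    by rewrite normr0 powR0// gt_eqF.
  rewrite esum_fset; [|exact: finite_seq|]; last first.
    by move=> g _; rewrite lee_fin powR_ge0.
  rewrite -fsbig_seq// sumEFin big_const_seq count_predT iter_addr addr0.
  by rewrite mulr_natl.
split; first by rewrite /lp_space/= SE ltry.
by rewrite /lp_norm SE/= powR_le1 ?invr_gt0// mulr_ge0 ?powR_ge0.
Qed.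

End lp_balls.

(** * Counting separated points *)

Section entropy.
Context {R : realType} {G : groupType}.

(** A point is coded by the list of its large coordinates on [E], together with
    their values rounded to multiples of [t].  By the hypothesis on [n] at most
    [n] coordinates are large, and two points with the same code are closer
    than [2 t] at every coordinate: a coordinate is either large for one of
    them, hence occurs in the common code, or small for both. *)
Lemma lp_ball_separated_card (p t : R) (n : nat) (E : seq G) (T : finType)
    (X : T -> G -> R) :
  0 < p -> 0 < t -> 1 < n.+1%:R * t `^ p -> uniq E -> (0 < size E)%N ->
  (forall i, lp_ball p (X i)) ->
  (forall i j, i != j -> exists2 g, g \in E & t *+ 2 <= `|X i g - X j g|) ->
  (#|T| <= (size E * (Num.truncn (2 / t)).+1) ^ n)%N.
Proof.
case: E => [//|g0 E']; move En : (g0 :: E') => E p0 t0 nt uE _ Xp Xsep.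
have sE : size E = (size E').+1 by rewrite -En.
rewrite sE.
pose large i := [seq g <- E | t <= `|X i g|].
have large_size i : (size (large i) <= n)%N.
  rewrite size_filter leqNgt; apply/negP => nl.
  move: nt; rewrite ltNge => /negP; apply.
  apply: le_trans (lp_ball_count_large _ _ _ _ p0 (ltW t0) (Xp i) uE).
  by rewrite ler_wpM2r ?powR_ge0// ler_nat.
(* Codes have length exactly [n]: short lists of large coordinates are padded
   with [g0], which is harmless since its rounded value is recorded as well. *)
pose pos i (k : nat) := nth g0 (large i) k.
have posE i k : pos i k \in E.
  rewrite /pos; have [kl|kl] := ltnP k (size (large i)).
    by have := mem_nth g0 kl; rewrite mem_filter => /andP[].
  by rewrite nth_default// -En mem_head.
(* Values lie in [-1, 1]; the shift by 1 makes them nonnegative. *)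
pose quant v : 'I_(Num.truncn (2 / t)).+1 := inord (Num.truncn ((v + 1) / t)).
have quantP i j g : quant (X i g) = quant (X j g) -> `|X i g - X j g| < t.
  have X1 l : (0 <= (X l g + 1) / t) && ((X l g + 1) / t <= 2 / t).
    have := lp_ball_coord_le1 _ _ g p0 (Xp l).
    rewrite ler_norml => /andP[X1 X2].
    by rewrite divr_ge0 ?(ltW t0) -?lerBlDr ?sub0r// ler_pM2r ?invr_gt0// lerD.
  have [/andP[Xi0 Xi2] /andP[Xj0 Xj2]] := (X1 i, X1 j).
  move=> /(congr1 val); rewrite /= !inordK ?ltnS ?le_truncn// => eqq.
  have := truncn_itv Xi0; have := truncn_itv Xj0; rewrite eqq.
  move=> /andP[j1 j2] /andP[i1 i2].
  have -> : X i g - X j g = ((X i g + 1) / t - (X j g + 1) / t) * t.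
    by rewrite mulrBl !divfK ?gt_eqF// opprD addrACA subrr addr0.
  rewrite normrM (gtr0_norm t0) gtr_pMl// ltr_norml; apply/andP; split.
    rewrite ltrBrDl; apply: lt_le_trans i1; rewrite ltrBlDr.
    by rewrite natr1.
  by rewrite ltrBlDr; apply: lt_le_trans i2 _; rewrite -natr1 addrC lerD2l.
pose code i : {ffun 'I_n -> 'I_(size E').+1 * 'I_(Num.truncn (2 / t)).+1} :=
  [ffun k : 'I_n => (inord (index (pos i k) E), quant (X i (pos i k)))].
have codeP i j g : code i = code j -> g \in E -> t <= `|X i g| ->
    quant (X i g) = quant (X j g).
  move=> eqc gE tg; have gl : g \in large i by rewrite mem_filter tg.
  have kn : (index g (large i) < n)%N.
    by rewrite (leq_trans _ (large_size i))// index_mem.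
  move/ffunP: eqc => /(_ (Ordinal kn)); rewrite !ffunE /= => -[].
  rewrite {1 3}/pos nth_index// => /(congr1 val).
  rewrite /= !inordK -?sE ?index_mem// => eqi eqq.
  have eqg : g = pos j (index g (large i)).
    by rewrite -[LHS](nth_index g0 gE) eqi nth_index ?posE.
  by rewrite eqq -eqg.
have code_inj : injective code.
  move=> i j eqc; apply/eqP/negPn/negP => /Xsep[g gE].
  rewrite leNgt => /negP; apply.
  have [ti|ti] := leP t `|X i g|.
    rewrite (lt_le_trans (quantP _ _ _ (codeP _ _ _ eqc gE ti)))//.
    by rewrite mulr2n lerDl ltW.
  have [tj|tj] := leP t `|X j g|.
    rewrite distrC.
    rewrite (lt_le_trans (quantP _ _ _ (codeP _ _ _ (esym eqc) gE tj)))//.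
    by rewrite mulr2n lerDl ltW.
  by rewrite (le_lt_trans (ler_normB _ _))// mulr2n ltrD.
by have := leq_card _ code_inj; rewrite card_ffun card_prod !card_ord.
Qed.

Lemma infinite_block_injection (m k : nat) : infinite_set [set: G] ->
  exists h : 'I_m * 'I_k -> G, injective h.
Proof.
move=> /(@infinite_set_fset _ _ (m * k))[B _ sB].
have rB (u : 'I_m * 'I_k) : (enum_rank u < size (enum_fset B))%N.
  rewrite (leq_trans (ltn_ord _))//.
  by rewrite card_prod !card_ord.
exists (fun u => nth 1%g (enum_fset B) (enum_rank u)) => u v /eqP.
by rewrite nth_uniq ?rB ?fset_uniq// => /eqP/val_inj/enum_rank_inj.
Qed.

End entropy.

(** At scale [t] a point of l^p has at most [n] coordinates larger than [t],
    while [n + 1] coordinates of size [eps], with [eps ^ q = c * t ^ s], fit in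
    the unit ball of l^q.  Since [n + 1 <= 2 t ^ - p], the second condition
    holds once [2 c t ^ (s - p) <= 1]. *)
Lemma exists_scale_fewer_large_coords {R : realType} (c p s : R) :
  0 < c -> 0 < p -> p < s -> exists (t : R) (n : nat),
    [/\ 0 < t, 1 < n.+1%:R * t `^ p & n.+1%:R * (c * t `^ s) <= 1].
Proof.
move=> c0 p0 ps; have sp0 : 0 < s - p by rewrite subr_gt0.
have c1 : 0 < 2 * c + 1 by rewrite addr_gt0// mulr_gt0.
pose t := (2 * c + 1)^-1 `^ (s - p)^-1.
have t0 : 0 < t by rewrite powR_gt0// invr_gt0.
have tsp : t `^ (s - p) = (2 * c + 1)^-1.
  by rewrite -powRrM mulVf ?gt_eqF// powRr1// invr_ge0 ltW.
have t1 : t <= 1.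
  rewrite powR_le1 ?invr_gt0 ?invr_ge0 ?(ltW c1)// invf_le1//.
  by rewrite lerDr mulr_ge0 ?ltW.
have tp1 : t `^ p <= 1 by rewrite powR_le1// ltW.
have tp0 : 0 < t `^ p by rewrite powR_gt0.
exists t, (Num.truncn (t `^ p)^-1); split => //.
  by rewrite -ltr_pdivrMr// mul1r truncnS_gt.
have -> : s = p + (s - p) by rewrite addrC subrK.
rewrite powRD; last by rewrite (gt_eqF t0) implybT.
rewrite tsp mulrCA -natr1.
have le2 : (Num.truncn (t `^ p)^-1)%:R + 1 <= 2 * (t `^ p)^-1.
  rewrite mulr_natl mulr2n lerD//; last by rewrite invf_ge1.
  by rewrite truncn_le invr_ge0 ltW.
rewrite mulrA [X in X * _]mulrC -!mulrA.
apply: le_trans (ler_wpM2r _ le2) _.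
  by rewrite !mulr_ge0 ?invr_ge0 ?(ltW c0) ?(ltW c1) ?(ltW tp0).
rewrite -mulrA [c * _]mulrCA mulKf ?gt_eqF// mulrA ler_pdivrMr// mul1r.
by rewrite lerDl.
Qed.

Lemma exists_expn_succ_gt (n D : nat) :
  exists k, ((k * D) ^ n < k ^ n.+1)%N.
Proof.
exists (D ^ n).+1; rewrite expnMn expnS mulnC.
by rewrite ltn_pmul2r ?expn_gt0.
Qed.

(** * Equivariant Hoelder maps *)

Section no_hoelder_surjection.
Context {R : realType} {G : groupType}.
Variables (p q alpha : R).
Variables (F F' : nat -> {fset G}) (a a' : nat -> R) (r r' : \bar R).
Hypothesis data : metric_data F a r.
Hypothesis data' : metric_data F' a' r'.
Hypotheses (p0 : 0 < p) (q0 : 0 < q) (alpha0 : 0 < alpha).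
Hypothesis pq : p < alpha * q.
Hypothesis infiniteG : infinite_set [set: G].

(** Equivariance moves the coordinate [g] of [f x] to the identity, where
    the target metric dominates it. *)
Lemma equivariant_hoelder_coord (f : @lp_ball R G p -> @lp_ball R G q) :
  equivariant f ->
  hoelder_map alpha (lp_ball_dist F a r) (lp_ball_dist F' a' r') f ->
  exists2 C : R, 0 < C & forall g x x', `|val (f x) g - val (f x') g| <=
    C * ball_dist F a r (translate g^-1 (val x)) (translate g^-1 (val x'))
      `^ alpha.
Proof.
move=> feq [c c0 fc].
have [C C0 HC] := coordinate_le_ball_dist _ _ _ data' 1%g.
exists (C * c); first exact: mulr_gt0.
move=> g x x'.
have valact s (z : @lp_ball R G s) :
    val z g = val (ball_act g^-1 z) 1%g by rewrite /= /translate invgK mulg1.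
rewrite (valact _ (f x)) (valact _ (f x')) -!feq -mulrA.
apply: le_trans (HC _ _ _ _) _; try by
  move=> h; apply: lp_ball_coord_le1 q0 (set_valP _).
by rewrite ler_wpM2l ?(ltW C0)//; exact: fc.
Qed.

(** A section [g] of [f] chooses the preimages whose separation is counted. *)
Lemma no_equivariant_hoelder_surjection
    (f : @lp_ball R G p -> @lp_ball R G q)
    (g : @lp_ball R G q -> @lp_ball R G p) :
  equivariant f -> cancel g f ->
  ~ hoelder_map alpha (lp_ball_dist F a r) (lp_ball_dist F' a' r') f.
Proof.
move=> feq gK fH.
have [C C0 HC] := equivariant_hoelder_coord _ feq fH.
have c0 : 0 < (C * 4 `^ alpha) `^ q.
  by rewrite powR_gt0// mulr_gt0// powR_gt0.
have [t [n [t0 nt nc]]] := exists_scale_fewer_large_coords _ _ _ c0 p0 pq.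
(* Points whose translates by [u^-1] are at distance less than [4 t] have images
   that differ by less than [eps] at the coordinate [u]. *)
pose eps := C * (4 * t) `^ alpha.
have eps0 : 0 < eps by rewrite mulr_gt0// powR_gt0// mulr_gt0.
have epsq : n.+1%:R * eps `^ q <= 1.
  apply: le_trans nc; rewrite ler_wpM2l// /eps.
  by rewrite [(4 * t) `^ _]powRM ?(ltW t0)// mulrA powRM ?powR_ge0 ?mulr_ge0
    ?powR_ge0 ?(ltW C0)// -powRrM.
have t2 : 0 <= 2 * t by rewrite mulr_ge0// ltW.
have t24 : 2 * t < 4 * t by rewrite ltr_pM2r// ltr_nat.
have [K0 HK] := ball_dist_lt_of_finite _ _ _ data _ _ t2 t24.
(* The identity is added to make the window [E] below nonempty. *)
pose K := 1%g :: K0.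
pose D := (n.+1 * size K * (Num.truncn (2 / t)).+1)%N.
have [k kD] := exists_expn_succ_gt n D.
have [h h_inj] := infinite_block_injection n.+1 k infiniteG.
pose supp (s : {ffun 'I_n.+1 -> 'I_k}) := [seq h (j, s j) | j : 'I_n.+1].
have supp_uniq s : uniq (supp s).
  by rewrite map_inj_uniq ?enum_uniq// => i j /h_inj[].
have Yq s : lp_ball q (fun u => if u \in supp s then eps else 0).
  by apply: lp_ball_indicator; rewrite ?(ltW eps0)// size_map size_enum_ord.
pose Y s : @lp_ball R G q := SigSub (mem_set (Yq s)).
have fgY s u : val (f (g (Y s))) u = if u \in supp s then eps else 0.
  by rewrite (gK (Y s)).
pose E := undup [seq (h u * v)%g | u <- enum {: 'I_n.+1 * 'I_k}, v <- K].
have sizeE : (size E <= n.+1 * k * size K)%N.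
  rewrite (leq_trans (size_undup _))// size_allpairs -cardE.
  by rewrite card_prod !card_ord.
have memE u v : v \in K -> (h u * v)%g \in E.
  move=> vK; rewrite mem_undup; apply/allpairsP.
  by exists (u, v); rewrite mem_enum.
have E_gt0 : (0 < size E)%N.
  have k0 : (0 < k)%N by case: (k) kD => //; rewrite exp0n.
  have := memE (ord0, Ordinal k0) 1%g (mem_head _ _).
  by case: (E).
have sep i j : i != j ->
    exists2 u, u \in E & t *+ 2 <= `|val (g (Y i)) u - val (g (Y j)) u|.
  move=> ij; have [l ijl] : exists l, i l != j l.
    by apply/existsP; apply: contraNT ij => /existsPn ij;
      apply/eqP/ffunP => l; have /negPn/eqP := ij l.
  (* At [h (l, i l)] the first image takes the value [eps], the second 0. *)
  apply: contrapT => noE.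
  have := HC (h (l, i l)) (g (Y i)) (g (Y j)).
  rewrite (fgY i) (fgY j) ifT; last by rewrite map_f ?mem_enum.
  rewrite ifF; last first.
    apply/negP => /mapP[l' _ /h_inj[<- /eqP]]; exact/negP.
  rewrite subr0 gtr0_norm// leNgt => /negP; apply.
  rewrite ltr_pM2l// gt0_ltr_powR ?nnegrE ?mulr_ge0 ?(ltW t0)//.
    by apply: (ball_dist_ge0 _ _ _ data) => v;
      apply: lp_ball_coord_le1 p0 (lp_ball_translate _ _).
  apply: HK => [v|v|v vK0]; try
    exact: lp_ball_coord_le1 p0 (lp_ball_translate _ _).
  rewrite /translate invgK leNgt; apply/negP => big; apply: noE.
  exists (h (l, i l) * v)%g; first by rewrite memE// inE vK0 orbT.
  by rewrite -mulr_natl ltW.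
have := lp_ball_separated_card p t n E _ (fun i => val (g (Y i))) p0 t0 nt
  (undup_uniq _) E_gt0 (fun i => set_valP _) sep.
rewrite card_ffun !card_ord leqNgt => /negP; apply.
apply: leq_ltn_trans kD.
have ED : (size E * (Num.truncn (2 / t)).+1 <= k * D)%N.
  by rewrite mulnA leq_mul2r mulnA [(k * _)%N]mulnC sizeE orbT.
by have [->|n0] := posnP n; rewrite ?expn0// leq_exp2r.
Qed.

End no_hoelder_surjection.

(** * Lipschitz and Hoelder homeomorphisms of unit balls *)

Theorem theorem1p1 (R : realType) (G : groupType)
    (countableG : countable [set: G]) (infiniteG : infinite_set [set: G])
    (p q : R) (p1 : 1 <= p) (q1 : 1 <= q)
    (F F' : nat -> {fset G}) (a a' : nat -> R) (r r' : \bar R)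
    (dataFar : metric_data F a r) (dataFar' : metric_data F' a' r') :
  let dp := @lp_ball_dist R G p F a r in
  let dq := @lp_ball_dist R G q F' a' r' in
  (p < q ->
    ~ exists f : @lp_ball R G p -> @lp_ball R G q,
        [/\ equivariant f, homeomorphism dp dq f & lipschitz_map dp dq f]) /\
  (forall alpha : R, 0 < alpha -> alpha <= 1 -> p < alpha * q ->
    ~ exists f : @lp_ball R G p -> @lp_ball R G q,
        [/\ equivariant f, homeomorphism dp dq f
          & hoelder_map alpha dp dq f]).
Proof.
move=> dp dq.
have p0 : 0 < p by exact: lt_le_trans p1.
have q0 : 0 < q by exact: lt_le_trans q1.
split=> [pq [f [feq [g [_ gK _ _]] [c c0 fL]]]|].
  have pq1 : p < 1 * q by rewrite mul1r.
  apply: (no_equivariant_hoelder_surjection _ _ _ _ _ _ _ _ _ dataFar dataFar'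
    p0 q0 ltr01 pq1 infiniteG f g feq gK).
  exists c; first exact: c0.
  move=> x y; have d0 : 0 <= dp x y.
    by apply: (ball_dist_ge0 _ _ _ dataFar) => h;
      apply: lp_ball_coord_le1 p0 (set_valP _).
  rewrite (powRr1 d0); exact: fL.
move=> alpha alpha0 _ pq [f [feq [g [_ gK _ _]] fH]].
exact: (no_equivariant_hoelder_surjection _ _ _ _ _ _ _ _ _ dataFar dataFar'
  p0 q0 alpha0 pq infiniteG f g feq gK fH).
Qed.
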